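(* Let $p$ be a prime and let $G$ be a finite $p$-group with $G\in\mathcal{P}_3$, i.e. $G$ has nilpotency class greater than $3$ and every proper subgroup of $G$ has nilpotency class at most $3$. If $p=2$ or $p=3$, then $c(G)\leqslant 5$.
   Context: For a finite $p$-group $G$, $c(G)$ denotes its nilpotency class. For a positive integer $n$, $\mathcal{P}_n$ denotes the set of all $p$-groups of nilpotency class $>n$ in which every proper subgroup has nilpotency class at most $n$. *)

(* Defs.v *)
From mathcomp Require Import all_boot all_fingroup all_solvable.

Set Implicit Arguments.
Unset Strict Implicit.
Unset Printing Implicit Defensive.

Local Open Scope group_scope.

(* Membership of G in the class P_n. [nil_class] is the actual nilpotency class
   only for nilpotent groups; here every group involved is a p-group. *)
Definition minimal_class_gt (p n : nat) (gT : finGroupType) (G : {group gT}) :=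
  [/\ p.-group G,
      (n < nil_class G)%N
    & forall H : {group gT}, H \proper G -> (nil_class H <= n)%N].

(* Main.v *)
Require Import Defs.
From mathcomp Require Import all_boot all_fingroup all_solvable.
From mathcomp Require Import zify.

Set Implicit Arguments.
Unset Strict Implicit.
Unset Printing Implicit Defensive.

Local Open Scope group_scope.

(* All the work takes place in left-normed commutators [x1, ..., xn].  If M is a
   maximal subgroup, a commutator with four entries in M lies in gamma_4(M) = 1.
   Since G is the product of two maximal subgroups, gamma_7(G) = 1; and if G has
   three maximal subgroups not all containing M1 /\ M2, then G is generated by
   their pairwise intersections, every element of which counts for two of them,
   so that gamma_6(G) = 1 already.

   Otherwise G = <a, b>.  With u = [a, b], the map
   f(y1,y2,y3,y4) = [u,y1,y2,y3,y4] is multiplicative in each entry, has exponent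
   p, vanishes if three entries are equal, and f(a,b,_,_) = f(b,a,_,_): only the
   six words with two a's and two b's matter.  The Lie relations alone leave one
   free parameter; the rest comes from the fact that p-th powers lie in every
   maximal subgroup.
   - p = 2: g(x,y,z) = [u,x,y,z]^2 is multiplicative and [u,x,y^2,x] = 1 reads
     g(x,y,x) f(x,y,y,x) = 1; similarly g(x,x,y) f(x,x,y,y) = 1.  Taking x = ab
     and y = b, and comparing with f(ab,ab,ab,a) = 1, kills f.
   - p = 3: h(x,y) = [u,x,y]^3 is multiplicative and [x,y^3,x,x] = 1 reads
     h(x,x) f(y,y,x,x) = 1 whenever [x,y] = u.  Since [ba,b] = [a,b], this may be
     used with x = a, ba and bba, and gives h(b,b)^2 = 1. *)

(** * Left-normed commutators and the lower central series *)

Definition commf (gT : finGroupType) : gT -> seq gT -> gT :=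
  foldl (fun x y => [~ x, y]).

Section LowerCentral.

Variables (gT : finGroupType) (G : {group gT}).
Implicit Types (x y z g : gT) (s : seq gT) (N H K L : {group gT}).

(** The three subgroup lemma, read in the quotient by N. *)
Lemma three_subgroup_sub N H K L :
    H \subset 'N(N) -> K \subset 'N(N) -> L \subset 'N(N) ->
    [~: H, K, L] \subset N -> [~: K, L, H] \subset N ->
  [~: L, H, K] \subset N.
Proof.
move=> nH nK nL sHKL sKLH.
have nC (A B : {group gT}) :
    A \subset 'N(N) -> B \subset 'N(N) -> [~: A, B] \subset 'N(N).
  by move=> nA nB; rewrite (subset_trans (commg_sub _ _)) // join_subG nA.
rewrite -quotient_sub1 ?nC // !quotientR ?nC //; apply/trivgP.
by apply: three_subgroup; apply/trivgP; rewrite /= -!quotientR ?nC // quotient_sub1 ?nC.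
Qed.

(** Induction on j: by the three subgroup lemma it suffices to bound [G, L_i, L_(j+1)] and
    [L_i, L_(j+1), G], and both fall under the induction hypothesis, the former at i + 1. *)
Lemma lcn_comm i j : [~: 'L_i(G), 'L_j(G)] \subset 'L_(i + j)(G).
Proof.
elim: j i => [|[|j] IHj] i.
- by rewrite addn0 lcn0 (subset_trans (lcnSnS _ _)) // lcn_subS.
- by rewrite addn1 lcn1 lcnSnS.
rewrite lcnSn commGC.
have := @three_subgroup_sub 'L_(i + j.+2)(G) G 'L_i(G) 'L_j.+1(G).
rewrite !(lcn_norm, subset_trans (lcn_sub _ _) (lcn_norm _ _)) //; apply=> //.
  by rewrite -addSnnS (subset_trans _ (IHj i.+1)) // commSg // commGC lcnSnS.
rewrite (subset_trans (commSg _ (IHj i))) // (addnS i j.+1); exact: lcnSnS.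
Qed.

Lemma mem_lcn_comm i j k x y :
  x \in 'L_i(G) -> y \in 'L_j(G) -> (k <= i + j)%N -> [~ x, y] \in 'L_k(G).
Proof.
move=> Lx Ly le_k; apply: (subsetP (lcn_sub_leq _ le_k)).
exact: (subsetP (lcn_comm i j)) (mem_commg Lx Ly).
Qed.

Lemma mem_lcn_commS i x g : x \in 'L_i(G) -> g \in G -> [~ x, g] \in 'L_i.+1(G).
Proof. by move=> Lx Gg; rewrite (@mem_lcn_comm i 1) ?addn1. Qed.

Lemma mem_lcn_leq i j x : x \in 'L_j(G) -> (i <= j)%N -> x \in 'L_i(G).
Proof. by move=> Lx le_ij; apply: subsetP Lx; apply: lcn_sub_leq. Qed.

Lemma mem_lcn_commf i x s :
  x \in 'L_i(G) -> all (mem G) s -> commf x s \in 'L_(i + size s)(G).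
Proof.
elim: s i x => [|g s IHs] i x Lx /=; first by rewrite addn0.
by case/andP=> Gg Gs; rewrite addnS -addSn IHs ?mem_lcn_commS.
Qed.

(** Congruence modulo ['L_i(G)], kept as a relation on elements so that no quotient groups are
    needed while the level i varies. *)
Definition eqlcn i x y := x * y^-1 \in 'L_i(G).

Lemma eqlcn_refl i x : eqlcn i x x.
Proof. by rewrite /eqlcn mulgV group1. Qed.

Lemma eqlcn_sym i x y : eqlcn i x y -> eqlcn i y x.
Proof. by rewrite /eqlcn -groupV invMg invgK. Qed.

Lemma eqlcn_trans i y x z : eqlcn i x y -> eqlcn i y z -> eqlcn i x z.
Proof.
by rewrite /eqlcn => xy yz; rewrite -(mulgKV y x) -mulgA groupM.
Qed.

Lemma eqlcnM i x y x' y' : x \in G -> eqlcn i x y -> eqlcn i x' y' ->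
  eqlcn i (x * x') (y * y').
Proof.
rewrite /eqlcn => Gx xy xy'.
have -> : x * x' * (y * y')^-1 = (x' * y'^-1) ^ x^-1 * (x * y^-1).
  by rewrite conjgE invgK invMg !mulgA mulgKV.
by rewrite groupM // memJ_norm // (subsetP (lcn_norm _ _)) ?groupV.
Qed.

Lemma eqlcn_mulr i x e : x \in G -> e \in 'L_i(G) -> eqlcn i (x * e) x.
Proof.
move=> Gx Le; rewrite /eqlcn -mulgA -{1}(invgK x) -conjgE.
by rewrite memJ_norm // (subsetP (lcn_norm _ _)) ?groupV.
Qed.

(** With x = ey and e in ['L_i(G)], [x, g] = [e, g]^y [y, g]; commutation gains one level. *)
Lemma eqlcn_commg i x y g : y \in G -> g \in G -> eqlcn i x y ->
  eqlcn i.+1 [~ x, g] [~ y, g].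
Proof.
move=> Gy Gg xy; rewrite /eqlcn -{1}(mulgKV y x) commMgJ mulgK.
by rewrite memJ_norm ?(subsetP (lcn_norm _ _)) // mem_lcn_commS.
Qed.

Lemma eqlcn_commf i x y s : y \in G -> all (mem G) s -> eqlcn i x y ->
  eqlcn (i + size s) (commf x s) (commf y s).
Proof.
elim: s i x y => [|g s IHs] i x y Gy /=; first by rewrite addn0.
case/andP=> Gg Gs xy; rewrite addnS -addSn IHs ?groupR //.
exact: eqlcn_commg.
Qed.

Lemma commf1 s : commf (1 : gT) s = 1.
Proof. by elim: s => //= g s; rewrite /commf /= comm1g. Qed.

(** In [xy, g] = [x, g] [x, g, y] [y, g] the middle factor has weight at least 2i + 3 >= i + 3, one
    more than [x, g]; further entries preserve the gap. *)
Lemma commfM i x y s : x \in 'L_i.+1(G) -> y \in 'L_i.+1(G) -> all (mem G) s ->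
  eqlcn (i.+1 + size s).+1 (commf (x * y) s) (commf x s * commf y s).
Proof.
elim: s i x y => [|g s IHs] i x y Lx Ly /=; first by rewrite eqlcn_refl.
case/andP=> Gg Gs.
have [Gx Gy] := (subsetP (lcn_sub _ _) _ Lx, subsetP (lcn_sub _ _) _ Ly).
have [Lxg Lyg] := (mem_lcn_commS Lx Gg, mem_lcn_commS Ly Gg).
rewrite addnS -addSn; apply: eqlcn_trans (IHs _ _ _ Lxg Lyg Gs).
rewrite -[(_ + _).+1]addSn eqlcn_commf ?(groupR, groupM) //.
rewrite commMgR; apply: eqlcnM; first by rewrite groupM ?groupR.
  apply: eqlcn_mulr; first by rewrite groupR.
  by apply: mem_lcn_comm Lxg Ly _; rewrite addSn addnS !ltnS leq_addr.
exact: eqlcn_refl.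
Qed.

(** With w the commutator preceding the entry, [w, zz'] = [w, z'] [w, z] [w, z, z']; swapping the
    first two factors and dropping the third costs only terms of higher weight. *)
Lemma commfMr i x s1 z z' s2 : x \in 'L_i.+1(G) ->
    all (mem G) s1 -> all (mem G) s2 -> z \in G -> z' \in G ->
  eqlcn (i.+1 + size s1 + size s2).+2 (commf x (s1 ++ z * z' :: s2))
    (commf x (s1 ++ z :: s2) * commf x (s1 ++ z' :: s2)).
Proof.
move=> Lx Gs1 Gs2 Gz Gz'; rewrite /commf !foldl_cat /=.
set w := foldl _ x s1.
have Lw: w \in 'L_(i.+1 + size s1)(G) by apply: mem_lcn_commf.
have [Lwz Lwz'] := (mem_lcn_commS Lw Gz, mem_lcn_commS Lw Gz').
have Gw: w \in G by exact: (subsetP (lcn_sub _ _)) Lw.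
apply: eqlcn_trans (commfM Lwz Lwz' Gs2).
rewrite -[X in eqlcn X]/((i.+1 + size s1).+2 + size s2)%N.
apply: eqlcn_commf; rewrite // 1?groupM ?groupR //.
have Lwzz: [~ w, z, z'] \in 'L_(i.+1 + size s1).+2(G) by rewrite mem_lcn_commS.
rewrite commgMR; apply: eqlcn_trans (eqlcn_mulr _ Lwzz) _; first by rewrite groupM ?groupR.
have -> : [~ w, z'] * [~ w, z] = [~ w, z] * [~ w, z'] * [~ [~ w, z'], [~ w, z]].
  by rewrite commgC.
apply: eqlcn_mulr; first by rewrite groupM ?groupR.
by apply: mem_lcn_comm Lwz' Lwz _; rewrite addSn addnS !ltnS leq_addr.
Qed.

(** Modulo ['L_n.+2(G)], commutators of n + 1 entries are multiplicative in each entry, so the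
    entries that send them into T form a subgroup and it suffices to test generators. *)
Lemma lcn_sub_commf (X : {set gT}) (T : {group gT}) n :
    <<X>> = G -> 'L_n.+2(G) \subset T ->
    (forall x s, x \in X -> all (mem X) s -> size s = n -> commf x s \in T) ->
  'L_n.+1(G) \subset T.
Proof.
move=> genX sT TX; have sXG: X \subset G by rewrite -genX subset_gen.
have all_sub s : all (mem X) s -> all (mem G) s by apply/sub_all/subsetP.
have eqT x y : eqlcn n.+2 x y -> y \in T -> x \in T.
  by move=> xy Ty; rewrite -(mulgKV y x) groupM // (subsetP sT).
have eqT' x y : eqlcn n.+2 x y -> x \in T -> y \in T by move/eqlcn_sym/eqT.
(* [Q] interpolates: x has weight i + 1 and is followed by n - i generators. At i = n this is the
   goal; the induction reduces to i = 0. *)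
suffices Q i x s : (i <= n)%N -> x \in 'L_i.+1(G) -> all (mem X) s ->
    size s = (n - i)%N -> commf x s \in T.
  by apply/subsetP=> x Lx; apply: (Q n x [::]); rewrite ?subnn.
elim: i x s => [|i IHi] x s le_in Lx Xs def_s.
  rewrite subn0 lcn1 in def_s Lx; have Gs := all_sub s Xs.
  pose K := [set y in G | commf y s \in T].
  have gK: group_set K.
    apply/group_setP; split=> [|y z]; first by rewrite inE group1 commf1 group1.
    rewrite !inE => /andP[Gy Ty] /andP[Gz Tz]; rewrite groupM //=.
    apply: eqT (groupM Ty Tz); have := @commfM 0 y z s Gy Gz Gs.
    by rewrite def_s.
  suffices: G \subset Group gK by move/subsetP/(_ x Lx); rewrite inE => /andP[].
  rewrite -genX gen_subG; apply/subsetP=> y Xy; rewrite inE (subsetP sXG) //=.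
  exact: TX.
have Gs := all_sub s Xs.
pose K := [set y in 'L_i.+2(G) | commf y s \in T].
have gK: group_set K.
  apply/group_setP; split=> [|y z]; first by rewrite inE group1 commf1 group1.
  rewrite !inE => /andP[Gy Ty] /andP[Gz Tz]; rewrite groupM //=.
  apply: eqT (groupM Ty Tz); have := @commfM i.+1 y z s Gy Gz Gs.
  by rewrite def_s addSn subnKC.
suffices: 'L_i.+2(G) \subset Group gK.
  by move/subsetP/(_ x Lx); rewrite inE => /andP[].
rewrite lcnSn gen_subG; apply/subsetP=> _ /imset2P[y g Ly Gg ->].
rewrite inE mem_lcn_commS //=.
pose K' := [set z in G | commf [~ y, z] s \in T].
have gK': group_set K'.
  apply/group_setP; split=> [|z z']; first by rewrite inE commg1 group1 commf1 group1.
  rewrite !inE => /andP[Gz Tz] /andP[Gz' Tz']; rewrite groupM //=.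
  apply: eqT (groupM Tz Tz'); have := @commfMr i y [::] z z' s Ly isT Gs Gz Gz'.
  by rewrite /= addn0 def_s addSn -addnS -subSn // subSS subnKC // ltnW.
suffices: G \subset Group gK' by move/subsetP/(_ g Gg); rewrite inE => /andP[].
rewrite -genX gen_subG; apply/subsetP=> z Xz; rewrite inE (subsetP sXG) //=.
apply: (IHi y (z :: s)) => //=; rewrite ?Xz ?def_s ?subnSK //; exact: ltnW.
Qed.

End LowerCentral.

(** * Counting the entries of a commutator that lie in a normal subgroup *)

Section Counting.

Variables (gT : finGroupType) (G : {group gT}).
Implicit Types (x g : gT) (s : seq gT) (M : {group gT}).

Lemma commf_cat x s1 s2 : commf x (s1 ++ s2) = commf (commf x s1) s2.
Proof. exact: foldl_cat. Qed.

Lemma commf_rcons x s g : commf x (rcons s g) = [~ commf x s, g].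
Proof. exact: foldl_rcons. Qed.

(** Longer commutators of generators begin with a trivial one, so the terms vanish one after
    another, descending from the trivial term that nilpotency provides. *)
Lemma lcn_eq1_commf (X : {set gT}) n :
    nilpotent G -> <<X>> = G ->
    (forall x s, x \in X -> all (mem X) s -> size s = n -> commf x s = 1) ->
  'L_n.+1(G) = 1.
Proof.
move=> nilG genX X1; have [N LN] := lcnP _ nilG.
suffices LnN d : 'L_(n + d).+1(G) = 1 -> 'L_n.+1(G) = 1.
  by apply: (LnN N); apply/trivgP; rewrite -LN lcn_sub_leq // ltnS leq_addl.
elim: d => [|d IHd]; first by rewrite addn0.
rewrite addnS => Lnd; apply: IHd; apply/trivgP.
apply: (@lcn_sub_commf _ _ X) => //=; first by rewrite Lnd.
move=> x s Xx Xs def_s.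
rewrite -(cat_take_drop n s) commf_cat (X1 x (take n s)) ?commf1 ?group1 //.
  by apply/allP=> y /mem_take; apply: (allP Xs).
by rewrite size_takel // def_s leq_addr.
Qed.

(** Each entry in M raises the weight in the series of M by one; other entries preserve it, the
    terms of that series being normal in G. The bound 0 < k excludes ['L_0(M)], which is M by
    convention. *)
Lemma commf_count M x s k : M <| G -> all (mem G) (x :: s) ->
  (0 < k <= count (mem M) (x :: s))%N -> commf x s \in 'L_k(M).
Proof.
case/andP=> sMG nMG.
suffices main : all (mem G) (x :: s) -> (0 < count (mem M) (x :: s))%N ->
    commf x s \in 'L_(count (mem M) (x :: s))(M).
  move=> Gxs /andP[k0 le_k]; have m0 := leq_trans k0 le_k.
  by apply: subsetP (main Gxs m0); apply: lcn_sub_leq.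
elim/last_ind: s => [|s g IHs] /=.
  by rewrite addn0; case Mx: (x \in M) => //= _ _; rewrite lcn1.
rewrite all_rcons -cats1 count_cat /= addn0 addnA => /and3P[Gx Gg Gs].
rewrite cats1 commf_rcons => m0.
have Gxs: commf x s \in G.
  by have := @mem_lcn_commf _ G 0 x s; rewrite lcn0 => /(_ Gx Gs)/(subsetP (lcn_sub _ _)).
have {IHs} := IHs _; rewrite /= Gx Gs => /(_ isT); move: m0.
set m := (_ + count _ _)%N; have nMm := char_norm_trans (lcn_char m M) nMG.
(* If no earlier entry lies in M, the commutator enters M with g, by normality. *)
have [-> /= | m0 _ /(_ isT) Lm] := posnP m.
  case Mg: (g \in M) => //= _ _; rewrite lcn1.
  by rewrite commgEr groupM // memJ_norm ?groupV // (subsetP nMG).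
case Mg: (g \in M); last first.
  by rewrite addn0 commgEl groupM ?groupV // memJ_norm // (subsetP nMm).
by rewrite addn1 mem_lcn_commS.
Qed.

Lemma commf_count4 M x s : M <| G -> 'L_4(M) = 1 -> all (mem G) (x :: s) ->
  (4 <= count (mem M) (x :: s))%N -> commf x s = 1.
Proof.
move=> nMG M4 Gs c4; have := @commf_count M x s 4 nMG Gs c4.
by rewrite M4 => /set1gP.
Qed.

End Counting.

(** * Maximal subgroups and the number of generators *)

Section Rank.

Variables (gT : finGroupType) (p : nat) (G : {group gT}).
Implicit Types (M : {group gT}).
Hypotheses (pG : p.-group G) (ncG : ~~ cyclic G).
Hypothesis max4 : forall M, maximal M G -> 'L_4(M) = 1.

Lemma mem_maximal x : x \in G -> exists2 M : {group gT}, maximal M G & x \in M.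
Proof.
move=> Gx; have sxG: <[x]> \subset G by rewrite cycle_subG.
have [defG | [M maxM sxM]] := maximal_exists sxG; last by exists M; rewrite -?cycle_subG.
by case/negP: ncG; rewrite -defG cycle_cyclic.
Qed.

Lemma two_maximal : exists M1 M2 : {group gT},
  [/\ maximal M1 G, maximal M2 G & ~~ (M2 \subset M1)].
Proof.
have [M1 maxM1 _] := mem_maximal (group1 G).
have /proper_subn/subsetPn[x Gx notM1x] := maxgroupp maxM1.
have [M2 maxM2 M2x] := mem_maximal Gx.
by exists M1, M2; split=> //; apply/subsetPn; exists x.
Qed.

Lemma lcn7_eq1 : 'L_7(G) = 1.
Proof.
have [M1 [M2 [maxM1 maxM2 notM21]]] := two_maximal.
have [n1 n2] := (p_maximal_normal pG maxM1, p_maximal_normal pG maxM2).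
have defG: M1 * M2 = G.
  exact: mulg_normal_maximal n1 maxM1 (normal_sub n2) notM21.
apply: (@lcn_eq1_commf _ _ (M1 :|: M2)); first exact: pgroup_nil pG.
  apply/eqP; rewrite eqEsubset gen_subG subUset (normal_sub n1) (normal_sub n2) /= -{1}defG.
  by rewrite mul_subG // (subset_trans _ (subset_gen _)) ?subsetUl ?subsetUr.
move=> x s Xx Xs def_s.
have {Xx}Xs: all (mem (M1 :|: M2)) (x :: s) by rewrite /= Xx.
have Gs: all (mem G) (x :: s).
  apply: sub_all Xs => y; rewrite /= inE.
  by case/orP; apply/subsetP/normal_sub.
(* Each of the 7 entries counts for M1 or M2, so one of these gets at least 4. *)
have: (size (x :: s) <= count (mem M1) (x :: s) + count (mem M2) (x :: s))%N.
  elim: (x :: s) Xs => //= y r IHr /andP[]; rewrite inE => My /IHr.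
  move: (count _ r) (count _ r) (size r) => m1 m2 m.
  by case/orP: My => ->; clear; lia.
rewrite [size _]/= def_s => c7.
have [c4|c4] := leqP 4 (count (mem M1) (x :: s)).
  exact: commf_count4 n1 (max4 maxM1) Gs c4.
apply: commf_count4 n2 (max4 maxM2) Gs _; move: c4 c7.
by move: (count _ _) (count _ _) => m1 m2; clear; lia.
Qed.

Lemma lcn6_or_2gen :
  'L_6(G) = 1 \/ exists a b, [/\ a \in G, b \in G & <<[set a; b]>> = G].
Proof.
have [M1 [M2 [maxM1 maxM2 notM21]]] := two_maximal.
have [n1 n2] := (p_maximal_normal pG maxM1, p_maximal_normal pG maxM2).
have defG: M1 * M2 = G.
  exact: mulg_normal_maximal n1 maxM1 (normal_sub n2) notM21.
have [/existsP[M3 /andP[maxM3 notNM3]] | /existsPn allN] :=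
  boolP [exists M : {group gT}, maximal M G && ~~ (M1 :&: M2 \subset M)].
  have n3 := p_maximal_normal pG maxM3; left.
  have defG3: M3 * (M1 :&: M2) = G.
    by apply: mulg_normal_maximal => //; rewrite (subset_trans (subsetIl _ _)) ?normal_sub.
  (* By Dedekind's law, M3 (M1 :&: M2) = G gives M1 = (M1 :&: M3) (M1 :&: M2), and likewise for M2;
     hence X generates G. *)
  pose X := (M1 :&: M2) :|: (M1 :&: M3) :|: (M2 :&: M3).
  have sub12: M1 :&: M2 \subset <<X>> by rewrite sub_gen // /X -setUA subsetUl.
  have sub13: M1 :&: M3 \subset <<X>> by rewrite sub_gen // /X setUAC subsetUr.
  have sub23: M2 :&: M3 \subset <<X>> by rewrite sub_gen // /X subsetUr.
  have sXG: X \subset G by rewrite !subUset !(subset_trans (subsetIl _ _)) ?normal_sub.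
  apply: (@lcn_eq1_commf _ _ X); first exact: pgroup_nil pG.
    apply/eqP; rewrite eqEsubset gen_subG sXG /= -{1}defG mul_subG //.
      have <- : (M1 :&: M3) * (M1 :&: M2) = M1.
        by rewrite group_modr ?subsetIl // defG3 (setIidPl (normal_sub n1)).
      by rewrite mul_subG ?sub13 ?sub12.
    have <- : (M2 :&: M3) * (M1 :&: M2) = M2.
      by rewrite group_modr ?subsetIr // defG3 (setIidPl (normal_sub n2)).
    by rewrite mul_subG ?sub23 ?sub12.
  move=> x s Xx Xs def_s.
  have {Xx}Xs: all (mem X) (x :: s) by rewrite /= Xx.
  have Gs: all (mem G) (x :: s) by apply: sub_all Xs; apply/subsetP.
  (* Each of the 6 entries counts for two of the three subgroups; 12 > 3 + 3 + 3. *)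
  have: (2 * size (x :: s) <= count (mem M1) (x :: s) + count (mem M2) (x :: s)
      + count (mem M3) (x :: s))%N.
    elim: (x :: s) Xs => //= y r IHr /andP[]; rewrite !inE => My /IHr.
    move: (count _ r) (count _ r) (count _ r) (size r) => m1 m2 m3 m.
    by move: My; case: (y \in M1) (y \in M2) (y \in M3) => [] [] []; clear; lia.
  rewrite [size _]/= def_s => c12.
  have [c4|c4] := leqP 4 (count (mem M1) (x :: s)).
    exact: commf_count4 n1 (max4 maxM1) Gs c4.
  have [c4'|c4'] := leqP 4 (count (mem M2) (x :: s)).
    exact: commf_count4 n2 (max4 maxM2) Gs c4'.
  apply: commf_count4 n3 (max4 maxM3) Gs _; move: c4 c4' c12.
  by move: (count _ _) (count _ _) (count _ _) => m1 m2 m3; clear; lia.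
right.
have notM12: ~~ (M1 \subset M2).
  apply: contra notM21 => sM12; have [_ max1] := maxgroupP maxM1.
  by rewrite (max1 M2) ?(maxgroupp maxM2).
have [a M1a notM2a] := subsetPn notM12; have [b M2b notM1b] := subsetPn notM21.
have [Ga Gb] := (subsetP (normal_sub n1) a M1a, subsetP (normal_sub n2) b M2b).
exists a, b; split=> //; apply: Phi_nongen; apply/eqP.
(* All maximal subgroups contain M1 :&: M2, so it lies in the Frattini subgroup. By Dedekind's law
   it generates M1 together with a, and M2 together with b. *)
have sNP: M1 :&: M2 \subset 'Phi(G).
  apply/bigcapsP=> M; rewrite /maximal_eq => /predU1P[-> | maxM].
    by rewrite (subset_trans (subsetIl _ _)) ?normal_sub.
  by have := allN M; rewrite maxM negbK.
rewrite eqEsubset join_subG Phi_sub subUset !sub1set Ga Gb /= -{1}defG mul_subG //.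
  have defGa: M2 * <[a]> = G.
    by apply: mulg_normal_maximal; rewrite ?cycle_subG.
  have <- : (M1 :&: M2) * <[a]> = M1.
    by rewrite group_modr ?cycle_subG // defGa (setIidPl (normal_sub n1)).
  rewrite mul_subG // ?cycle_subG.
    by rewrite (subset_trans sNP) // joing_subl.
  by rewrite mem_gen // !inE eqxx orbT.
have defGb: M1 * <[b]> = G.
  by apply: mulg_normal_maximal; rewrite ?cycle_subG.
have <- : (M2 :&: M1) * <[b]> = M2.
  by rewrite group_modr ?cycle_subG // defGb (setIidPl (normal_sub n2)).
rewrite mul_subG // ?cycle_subG.
  by rewrite setIC (subset_trans sNP) // joing_subl.
by rewrite mem_gen // !inE eqxx !orbT.
Qed.

End Rank.

(** * Exact commutator identities in class at most 6 *)

Section Class6.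

Variables (gT : finGroupType) (G : {group gT}).
Implicit Types (a b c e g r t u v w x y z : gT) (s : seq gT).
Hypothesis L7 : 'L_7(G) = 1.

Lemma eqlcn7 x y : eqlcn G 7 x y -> x = y.
Proof. by rewrite /eqlcn L7 => /set1gP/eqP; rewrite -eq_mulgV1 => /eqP. Qed.

Lemma lcn_commute i j x y :
  x \in 'L_i(G) -> y \in 'L_j(G) -> (7 <= i + j)%N -> commute x y.
Proof.
move=> Lx Ly le7; apply/commgP; have := mem_lcn_comm Lx Ly le7.
by rewrite L7 => /set1gP ->.
Qed.

Lemma abelian_lcn i : (4 <= i)%N -> abelian 'L_i(G).
Proof.
move=> le4; apply/centsP=> x Lx y Ly; apply: lcn_commute Lx Ly _.
by rewrite (leq_trans _ (leq_add le4 le4)).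
Qed.

(** The error term [x, g, y] has weight 3 + 1 + 3 = 7. *)
Lemma commf_lcn3M x y s : x \in 'L_3(G) -> y \in 'L_3(G) -> all (mem G) s ->
  commf (x * y) s = commf x s * commf y s.
Proof.
elim: s x y => //= g s IHs x y Lx Ly /andP[Gg Gs].
have [Lxg Lyg] := (mem_lcn_commS Lx Gg, mem_lcn_commS Ly Gg).
rewrite -IHs ?(mem_lcn_leq Lxg) ?(mem_lcn_leq Lyg) //; congr commf.
by rewrite commMgJ conjgE (lcn_commute Lxg Ly) // mulKg.
Qed.

Lemma commf_lcn3X x s n : x \in 'L_3(G) -> all (mem G) s ->
  commf (x ^+ n) s = commf x s ^+ n.
Proof.
move=> Lx Gs; elim: n => [|n IHn]; first by rewrite commf1.
by rewrite !expgS commf_lcn3M ?IHn ?groupX.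
Qed.

Lemma lcn_expMn i x y q : (4 <= i)%N -> x \in 'L_i(G) -> y \in 'L_i(G) ->
  (x * y) ^+ q = x ^+ q * y ^+ q.
Proof. by move=> i4 Lx Ly; apply/expgMn/(centsP (abelian_lcn i4)). Qed.

(** With x = ey, x^q = e^q y^q since ['L_i(G)] is abelian for i >= 4, and e^q = 1. *)
Lemma eqlcn_expg i x y q : (4 <= i)%N -> y \in 'L_i(G) -> eqlcn G i.+1 x y ->
  (forall e, e \in 'L_i.+1(G) -> e ^+ q = 1) -> x ^+ q = y ^+ q.
Proof.
move=> i4 Ly xy q1; have Le := mem_lcn_leq xy (leqnSn i).
by rewrite -(mulgKV y x) (lcn_expMn _ i4) // (q1 _ xy) mul1g.
Qed.

Lemma commf_sqr w z s : w \in 'L_2(G) -> z \in G -> all (mem G) s ->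
  commf w (z ^+ 2 :: s) = commf w (z :: s) ^+ 2 * commf w [:: z, z & s].
Proof.
move=> Lw Gz Gs; rewrite /= -/(commf _ s).
have Lv := mem_lcn_commS Lw Gz; have Lv1 := mem_lcn_commS Lv Gz.
rewrite expgS expg1 commgMJ conjg_mulR mulgA -expg2.
by rewrite commf_lcn3M ?commf_lcn3X ?groupX // (mem_lcn_leq Lv1).
Qed.

(** Left as an unsorted word: v and v1 commute when w has weight 3 - 1 = 2, but the formula also
    serves for w of weight 1. *)
Lemma commg_cube w z : let v := [~ w, z] in let v1 := [~ v, z] in
  [~ w, z ^+ 3] = v * v * v1 * (v * v1 * v1 * [~ v1, z]).
Proof.
move=> v v1; have vz : v ^ z = v * v1 by rewrite conjg_mulR.
have v1z : v1 ^ z = v1 * [~ v1, z] by rewrite conjg_mulR.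
by rewrite expgSr expgS expg1 !commgMJ -/v vz (conjMg v) (conjMg v v1) vz v1z !mulgA.
Qed.

Lemma commf_cube w z s : w \in 'L_2(G) -> z \in G -> all (mem G) s ->
  commf w (z ^+ 3 :: s) = commf w (z :: s) ^+ 3 * commf w [:: z, z & s] ^+ 3
     * commf w [:: z, z, z & s].
Proof.
move=> Lw Gz Gs; rewrite [LHS]/= -/(commf _ s) commg_cube.
set v := [~ w, z]; set v1 := [~ v, z]; set v2 := [~ v1, z].
have Lv : v \in 'L_3(G) := mem_lcn_commS Lw Gz.
have Lv1 : v1 \in 'L_4(G) := mem_lcn_commS Lv Gz.
have Lv2 : v2 \in 'L_5(G) := mem_lcn_commS Lv1 Gz.
have cvv1 : commute v v1 by apply: lcn_commute Lv Lv1 _.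
have [Kv1 Kv2] : v1 \in 'L_3(G) /\ v2 \in 'L_3(G).
  by split; [apply: mem_lcn_leq Lv1 _ | apply: mem_lcn_leq Lv2 _].
rewrite -[RHS]/(commf v s ^+ 3 * commf v1 s ^+ 3 * commf v2 s).
clearbody v2; clearbody v1; clearbody v.
have -> : v * v * v1 * (v * v1 * v1 * v2) = v ^+ 3 * v1 ^+ 3 * v2.
  rewrite !expgS !expg0 !mulg1 !mulgA; congr (_ * _ * _ * _).
  by rewrite -!mulgA -cvv1.
by rewrite !commf_lcn3M ?commf_lcn3X ?groupM ?groupX.
Qed.

Lemma eqlcn_mulI i g x y : g \in G -> eqlcn G i (g * x) (g * y) -> eqlcn G i x y.
Proof.
move=> Gg; rewrite /eqlcn; have -> : g * x * (g * y)^-1 = (x * y^-1) ^ g^-1.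
  by rewrite conjgE invgK invMg !mulgA.
by rewrite memJ_norm // (subsetP (lcn_norm _ _)) ?groupV.
Qed.

Section FixedCommutator.

Variable u : gT.
Hypothesis Lu : u \in 'L_2(G).

(** The map f of the overview. Its values have weight 6, which makes it exactly multiplicative in
    each entry. *)
Definition comm4 x y z t := commf u [:: x; y; z; t].

Lemma comm4_mem x y z t : x \in G -> y \in G -> z \in G -> t \in G ->
  comm4 x y z t \in 'L_6(G).
Proof. by move=> *; apply: (@mem_lcn_commf _ _ 2) => //=; apply/and5P. Qed.

Lemma comm4M1 x x' y z t : x \in G -> x' \in G -> y \in G -> z \in G -> t \in G ->
  comm4 (x * x') y z t = comm4 x y z t * comm4 x' y z t.
Proof.
move=> Gx Gx' Gy Gz Gt; apply/eqlcn7.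
by apply: (@commfMr _ _ 1 u [::] x x' [:: y; z; t]) => //=; rewrite Gy Gz Gt.
Qed.

Lemma comm4M2 x y y' z t : x \in G -> y \in G -> y' \in G -> z \in G -> t \in G ->
  comm4 x (y * y') z t = comm4 x y z t * comm4 x y' z t.
Proof.
move=> Gx Gy Gy' Gz Gt; apply/eqlcn7.
by apply: (@commfMr _ _ 1 u [:: x] y y' [:: z; t]) => //=; rewrite ?Gx ?Gz ?Gt.
Qed.

Lemma comm4M3 x y z z' t : x \in G -> y \in G -> z \in G -> z' \in G -> t \in G ->
  comm4 x y (z * z') t = comm4 x y z t * comm4 x y z' t.
Proof.
move=> Gx Gy Gz Gz' Gt; apply/eqlcn7.
by apply: (@commfMr _ _ 1 u [:: x; y] z z' [:: t]) => //=; rewrite ?Gx ?Gy ?Gt.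
Qed.

Lemma comm4M4 x y z t t' : x \in G -> y \in G -> z \in G -> t \in G -> t' \in G ->
  comm4 x y z (t * t') = comm4 x y z t * comm4 x y z t'.
Proof.
move=> Gx Gy Gz Gt Gt'; apply/eqlcn7.
by apply: (@commfMr _ _ 1 u [:: x; y; z] t t' [::]) => //=; rewrite ?Gx ?Gy ?Gz.
Qed.

Lemma comm4X1 x y z t n : x \in G -> y \in G -> z \in G -> t \in G ->
  comm4 (x ^+ n) y z t = comm4 x y z t ^+ n.
Proof.
move=> Gx Gy Gz Gt; elim: n => [|n IHn]; last by rewrite !expgS comm4M1 ?groupX ?IHn.
by rewrite /comm4 /= commg1 !comm1g.
Qed.

(* Compare the expansions of [u, xy] and [u, yx[x, y]]. *)
Lemma commg2_sym x y : x \in G -> y \in G -> commute u [~ x, y] ->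
  eqlcn G 5 [~ u, x, y] [~ u, y, x].
Proof.
move=> Gx Gy cu.
have [Lx Ly] := (mem_lcn_commS Lu Gx, mem_lcn_commS Lu Gy).
have Lxy : [~ x, y] \in 'L_2(G) by apply: (@mem_lcn_commS _ _ 1).
have Gu: u \in G by apply: (mem_lcn_leq Lu (isT : (1 <= 2)%N)).
have Gyx : [~ u, y * x] \in G by rewrite groupR ?groupM.
have: eqlcn G 5 [~ u, x * y] [~ u, y * x].
  move/commgP/eqP: cu => cu; rewrite (commgC x y) (commgMJ u (y * x)) cu mul1g conjg_mulR.
  apply: eqlcn_mulr => //.
  by apply: mem_lcn_comm Lxy _; first exact: (mem_lcn_commS Lu (groupM Gy Gx)).
have cancel P Q A B : P \in 'L_3(G) -> Q \in 'L_3(G) ->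
    eqlcn G 5 (Q * P * A) (P * Q * B) -> eqlcn G 5 A B.
  move=> LP LQ; rewrite (commgC P Q) -(mulgA (Q * P)).
  have GQP: Q * P \in G.
    by rewrite groupM ?(subsetP (lcn_sub _ _) _ LP) ?(subsetP (lcn_sub _ _) _ LQ).
  move/(eqlcn_mulI GQP)/eqlcn_trans; apply.
  by rewrite /eqlcn mulgK; apply: mem_lcn_comm LP LQ _.
by rewrite !commgMR; apply: cancel.
Qed.

Lemma comm4_sym x y z t : x \in G -> y \in G -> z \in G -> t \in G ->
  commute u [~ x, y] -> comm4 x y z t = comm4 y x z t.
Proof.
move=> Gx Gy Gz Gt cu; apply/eqlcn7; rewrite /comm4 /=.
have Gu: u \in G by apply: (mem_lcn_leq Lu (isT : (1 <= 2)%N)).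
have := @eqlcn_commf _ G 5 _ _ [:: z; t] _ _ (commg2_sym Gx Gy cu).
by apply; rewrite ?groupR //= Gz Gt.
Qed.

End FixedCommutator.
End Class6.

(** * Commutators that vanish because maximal subgroups have class at most 3 *)

Section Main.

Variables (gT : finGroupType) (p : nat) (G : {group gT}).
Implicit Types (a b c e g r t u v w x y z : gT) (s : seq gT).
Hypotheses (pG : p.-group G) (ncG : ~~ cyclic G).
Hypothesis max4 : forall M : {group gT}, maximal M G -> 'L_4(M) = 1.

Let L7 : 'L_7(G) = 1 := lcn7_eq1 pG ncG max4.

(** Frattini elements lie in every maximal subgroup, so u and all p-th powers count as entries
    whichever one is chosen. *)
Lemma lcn2_Phi u : u \in 'L_2(G) -> u \in 'Phi(G).
Proof. by move=> Lu; rewrite (Phi_joing pG) mem_gen // inE -lcn2 Lu. Qed.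

Lemma expp_Phi x : x \in G -> x ^+ p \in 'Phi(G).
Proof.
move=> Gx; rewrite (Phi_joing pG) mem_gen // inE orbC.
by rewrite (Mho_p_elt 1) // (mem_p_elt pG).
Qed.

(** Some maximal subgroup contains x, together with the whole Frattini subgroup. *)
Lemma commf_near x w s : x \in G -> all (mem G) (w :: s) ->
  (4 <= count [pred z | (z == x) || (z \in 'Phi(G))] (w :: s))%N ->
  commf w s = 1.
Proof.
move=> Gx Gs c4; have [M maxM Mx] := mem_maximal ncG Gx.
apply: (commf_count4 (p_maximal_normal pG maxM) (max4 maxM)) => //.
apply: leq_trans c4 (sub_count _ _) => y /= /orP[/eqP-> // |].
exact/subsetP/Phi_sub_max.
Qed.

(** P and Q prove that entries are in the Frattini subgroup; membership of the entries in G is left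
    to the caller. *)
Ltac near x P Q := apply: (@commf_near x) => //=;
  rewrite ?eqxx ?P ?Q ?orbT /= ?addnS ?addn0 ?add0n ?add1n // ?addnS //.

Section FixedCommutator.

Variable u : gT.
Hypothesis Lu : u \in 'L_2(G).

Local Notation f := (comm4 u).
Let Pu : u \in 'Phi(G) := lcn2_Phi Lu.
Let Gu : u \in G.
Proof. exact: subsetP (lcn_sub _ _) _ Lu. Qed.

Lemma comm4_xxxz x z : x \in G -> z \in G -> f x x x z = 1.
Proof. by move=> Gx Gz; near x Pu Pu; rewrite Gu Gx Gz. Qed.

Lemma comm4_xxzx x z : x \in G -> z \in G -> f x x z x = 1.
Proof. by move=> Gx Gz; near x Pu Pu; rewrite Gu Gx Gz. Qed.

Lemma comm4_xzxx x z : x \in G -> z \in G -> f x z x x = 1.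
Proof. by move=> Gx Gz; near x Pu Pu; rewrite Gu Gx Gz. Qed.

Lemma comm4_zxxx x z : x \in G -> z \in G -> f z x x x = 1.
Proof. by move=> Gx Gz; near x Pu Pu; rewrite Gu Gx Gz. Qed.

(** The power moves to the first entry. Two of y, z, t coincide; with u and x^p they make four
    entries in one maximal subgroup. *)
Lemma comm4_expp x y z t v w : x \in G -> y \in G -> v \in G -> w \in G ->
  z \in [set v; w] -> t \in [set v; w] -> y \in [set v; w] ->
  f x y z t ^+ p = 1.
Proof.
move=> Gx Gy Gv Gw zvw tvw yvw.
have [Gz Gt]: z \in G /\ t \in G by case/set2P: zvw => ->; case/set2P: tvw => ->.
rewrite -(comm4X1 L7 Lu) //; have Px := expp_Phi Gx.
case/set2P: yvw => ->; case/set2P: zvw => ->; case/set2P: tvw => ->;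
  solve [near v Pu Px; by rewrite Gu groupX // Gv ?Gw
        | near w Pu Px; by rewrite Gu groupX // Gw ?Gv].
Qed.

Definition comm4_vanish := (comm4_xxxz, comm4_xxzx, comm4_xzxx, comm4_zxxx).

End FixedCommutator.

(** * The case p = 2: relations between squares in weight 5 and words in weight 6 *)

Section ExponentTwo.

Hypothesis p2 : p = 2.
Hypothesis exp6 : forall e, e \in 'L_6(G) -> e ^+ 2 = 1.
Variables (u : gT).
Hypothesis Lu : u \in 'L_2(G).
Let Pu : u \in 'Phi(G) := lcn2_Phi Lu.
Let Gu : u \in G.
Proof. exact: subsetP (lcn_sub _ _) _ Lu. Qed.
Let sqrP x : x \in G -> x ^+ 2 \in 'Phi(G).
Proof. by rewrite -p2; apply: expp_Phi. Qed.

Local Notation f := (comm4 u).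
Local Notation fvan := (comm4_vanish Lu).

Let g x y z := commf u [:: x; y; z] ^+ 2.

(** The error of multiplicativity lies in ['L_6(G)], where squares are trivial. *)
Let gM1 x x' y z : x \in G -> x' \in G -> y \in G -> z \in G ->
  g (x * x') y z = g x y z * g x' y z.
Proof.
move=> Gx Gx' Gy Gz; have Gyz: all (mem G) [:: y; z] by rewrite /= Gy Gz.
have L5 v : v \in G -> commf u [:: v; y; z] \in 'L_5(G).
  by move=> Gv; apply: (@mem_lcn_commf _ _ 2) => //=; rewrite Gv Gy Gz.
rewrite -(lcn_expMn L7 2 (isT : (4 <= 5)%N)) ?L5 //.
apply: (eqlcn_expg L7 (isT : (4 <= 5)%N)) => //; first by rewrite groupM ?L5.
exact: (@commfMr _ _ 1 u [::] x x' [:: y; z]).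
Qed.

Let gM3 x y z z' : x \in G -> y \in G -> z \in G -> z' \in G ->
  g x y (z * z') = g x y z * g x y z'.
Proof.
move=> Gx Gy Gz Gz'; have Gxy: all (mem G) [:: x; y] by rewrite /= Gx Gy.
have L5 v : v \in G -> commf u [:: x; y; v] \in 'L_5(G).
  by move=> Gv; apply: (@mem_lcn_commf _ _ 2) => //=; rewrite Gv Gx Gy.
rewrite -(lcn_expMn L7 2 (isT : (4 <= 5)%N)) ?L5 //.
apply: (eqlcn_expg L7 (isT : (4 <= 5)%N)) => //; first by rewrite groupM ?L5.
exact: (@commfMr _ _ 1 u [:: x; y] z z' [::]).
Qed.

Let g_sym x y z : x \in G -> y \in G -> z \in G -> commute u [~ x, y] ->
  g x y z = g y x z.
Proof.
move=> Gx Gy Gz cu.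
apply: (eqlcn_expg L7 (isT : (4 <= 5)%N)) => //.
  by apply: (@mem_lcn_commf _ _ 2) => //=; rewrite Gx Gy Gz.
have := @eqlcn_commf _ G 5 _ _ [:: z] _ _ (commg2_sym Lu Gx Gy cu).
by apply; rewrite ?groupR //= Gz.
Qed.

Let g_xyx x y : x \in G -> y \in G -> g x y x * f x y y x = 1.
Proof.
move=> Gx Gy; have Py := sqrP Gy.
have Lw: [~ u, x] \in 'L_2(G) by apply: (mem_lcn_leq (mem_lcn_commS Lu Gx)).
transitivity (commf u [:: x; y ^+ 2; x]).
  by symmetry; apply: (@commf_sqr _ _ L7 [~ u, x] y [:: x]); rewrite //= Gx.
by near x Pu Py; rewrite Gu Gx groupX.
Qed.

Let g_xxy x y : x \in G -> y \in G -> g x x y * f x x y y = 1.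
Proof.
move=> Gx Gy; have Py := sqrP Gy.
have Lw: [~ u, x, x] \in 'L_2(G).
  by apply: (mem_lcn_leq (mem_lcn_commS (mem_lcn_commS Lu Gx) Gx)).
transitivity (commf u [:: x; x; y ^+ 2]).
  by symmetry; apply: (@commf_sqr _ _ L7 [~ u, x, x] y [::]).
by near x Pu Py; rewrite Gu Gx groupX.
Qed.

Lemma comm4_words2 a b : a \in G -> b \in G -> commute u [~ a, b] ->
  [/\ f b b a a = 1, f a b a b = 1 & f b a a b = 1].
Proof.
move=> Ga Gb cu; have cu' : commute u [~ b, a] by rewrite -invg_comm; apply: commuteV.
have Gc : a * b \in G by rewrite groupM.
(* Expanding f(ab, ab, ab, a) leaves abba, baba and bbaa; the first two agree, and their product is
   a square. *)
have bbaa : f b b a a = 1.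
  have := comm4_xxxz Lu Gc Ga.
  rewrite (comm4M1 L7 Lu) // !(comm4M2 L7 Lu) // !(comm4M3 L7 Lu) //
    !fvan // ?(mulg1, mul1g).
  rewrite (comm4_sym L7 Lu Gb Ga) // mulgA.
  by rewrite -expg2 exp6 ?mul1g // comm4_mem.
have gbba : g b b a = 1 by have := g_xxy Gb Ga; rewrite bbaa mulg1.
have gbbb : g b b b = 1.
  by have := g_xxy Gb Gb; rewrite fvan // mulg1.
(* The relation for (ab, b) expands to g(a,b,a) g(a,b,b) f(a,b,b,a) = 1; the relation for (a, b)
   cancels all but g(a,b,b). *)
have gabb : g a b b = 1.
  have := g_xyx Gc Gb.
  rewrite gM1 // !gM3 // gbba gbbb !mulg1 (comm4M1 L7 Lu) // !(comm4M4 L7 Lu) //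
    !fvan // ?(mulg1, mul1g).
  have cF : commute (g a b b) (f a b b a).
    apply: (lcn_commute (i := 1) L7 _ (comm4_mem Lu Ga Gb Gb Ga)) => //.
    by rewrite lcn1 groupX // !groupR.
  by rewrite -mulgA cF mulgA g_xyx // mul1g.
have baab : f b a a b = 1.
  by have := g_xyx Gb Ga; rewrite g_sym // gabb mul1g.
by split; rewrite // (comm4_sym L7 Lu Ga Gb).
Qed.

End ExponentTwo.

(** * The case p = 3: relations between cubes in weight 4 and words in weight 6 *)

Section ExponentThree.

Hypothesis p3 : p = 3.
Hypothesis exp5 : forall e, e \in 'L_5(G) -> e ^+ 3 = 1.

Let exp6 e : e \in 'L_6(G) -> e ^+ 3 = 1.
Proof. by move=> Le; rewrite exp5 ?(mem_lcn_leq Le). Qed.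

Let memLG i x : x \in 'L_i(G) -> x \in G.
Proof. exact/subsetP/lcn_sub. Qed.

(** With r = [v, x] and e = [r, v] central enough to move freely, the conjugates of r by 1, v, v^2
    contribute e^(0 + 1 + 2) = 1. *)
Let commg_expg3 v x : v \in 'L_2(G) -> x \in G -> [~ v ^+ 3, x] = [~ v, x] ^+ 3.
Proof.
move=> Lv Gx; have Lr := mem_lcn_commS Lv Gx.
have Le : [~ [~ v, x], v] \in 'L_5(G) by apply: mem_lcn_comm Lr Lv _.
have rv : [~ v, x] ^ v = [~ v, x] * [~ [~ v, x], v] by rewrite conjg_mulR.
have ev : [~ [~ v, x], v] ^ v = [~ [~ v, x], v].
  by rewrite conjgE (lcn_commute L7 Le Lv) // mulKg.
have cre : commute [~ v, x] [~ [~ v, x], v] by apply: lcn_commute Lr Le _.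
rewrite !expgS !expg0 !mulg1 commMgJ (commMgJ v v) conjgM rv conjMg rv ev.
move: (exp5 Le) cre; set e := [~ [~ v, x], v]; set r := [~ v, x].
move: (e) (r) => {Lr Le rv ev}{}e {}r e3 cre.
have reA z : z * e * r = z * r * e by rewrite -!mulgA cre.
have -> : r * e * e * (r * e * r) = r * r * r * e ^+ 3.
  by rewrite !expgS !expg0 !mulg1 !mulgA !reA.
by rewrite e3 mulg1 mulgA.
Qed.

Let commf_cube2 v v1 v2 x : v \in 'L_2(G) -> v1 \in 'L_3(G) -> v2 \in 'L_3(G) ->
    x \in G ->
  commf (v * v * v1 * (v * v1 * v1 * v2)) [:: x; x]
    = commf v [:: x; x] ^+ 3 * commf v1 [:: x; x] ^+ 3 * commf v2 [:: x; x].
Proof.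
move=> Lv Lv1 Lv2 Gx; have Gxx : all (mem G) [:: x; x] by rewrite /= Gx.
have [Gv Gv1 Gv2] := And3 (memLG Lv) (memLG Lv1) (memLG Lv2).
pose t := v1 ^+ 3 * v2; have Lt : t \in 'L_3(G) by rewrite groupM ?groupX.
have Gt := memLG Lt; have Gv3t : v ^+ 3 * t \in G by rewrite groupM ?groupX.
(* Sorting the word takes one swap of v1 and v; its error, of weight 5, dies after two more
   entries. *)
have -> : commf (v * v * v1 * (v * v1 * v1 * v2)) [:: x; x] = commf (v ^+ 3 * t) [:: x; x].
  apply: (eqlcn7 L7); apply: (@eqlcn_commf _ _ 5 _ _ [:: x; x]) => //.
  have Le : [~ v1, v] \in 'L_5(G) by apply: mem_lcn_comm Lv1 Lv _.
  suffices -> : v * v * v1 * (v * v1 * v1 * v2) = v ^+ 3 * t * [~ v1, v].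
    exact: eqlcn_mulr.
  have ce z : z \in 'L_3(G) -> commute [~ v1, v] z.
    by move=> Lz; apply: lcn_commute Le Lz _.
  move: (ce _ Lv1) (ce _ Lv2) (commgC v1 v); rewrite /t.
  set e := [~ v1, v]; move: (e) => {}e c1 c2 c12.
  have A1 z : z * e * v1 = z * v1 * e by rewrite -!mulgA c1.
  have A2 z : z * e * v2 = z * v2 * e by rewrite -!mulgA c2.
  have A12 z : z * v1 * v = z * v * v1 * e by rewrite -!mulgA c12 !mulgA.
  by rewrite !expgS !expg0 !mulg1 !mulgA A12 !A1 A2.
have Ls := mem_lcn_commS Lv Gx; have Lt1 := mem_lcn_commS Lt Gx.
(* The error [[v, x]^3, t] has weight 6 and dies with the last entry. *)
have -> : commf (v ^+ 3 * t) [:: x; x] = commf ([~ v, x] ^+ 3 * [~ t, x]) [:: x].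
  apply: (eqlcn7 L7); apply: (@eqlcn_commf _ _ 6 _ _ [:: x]) => //=; last 1 first.
  - rewrite commMgJ commg_expg3 // conjg_mulR -mulgA.
    have Le : [~ [~ v, x] ^+ 3, t] \in 'L_6(G) by apply: mem_lcn_comm (groupX 3 Ls) Lt _.
    rewrite (lcn_commute (j := 1) L7 Le (memLG Lt1)) // mulgA.
    by apply: eqlcn_mulr Le; rewrite groupM ?groupX // groupR.
  - by rewrite groupM ?groupX // groupR.
  - by rewrite Gx.
have Lt13 : [~ t, x] \in 'L_3(G) by apply: mem_lcn_leq Lt1 _.
have Gx1 : all (mem G) [:: x] by rewrite /= Gx.
rewrite (commf_lcn3M L7 (groupX 3 Ls) Lt13) // (commf_lcn3X L7) //.
rewrite -[RHS]mulgA -[commf [~ t, x] _]/(commf t [:: x; x]) /t.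
by rewrite (commf_lcn3M L7 (groupX 3 Lv1) Lv2) // (commf_lcn3X L7).
Qed.

(** [x, y^3, x, x] = 1 by counting; in its expansion the middle factor is a cube in ['L_5(G)], hence
    trivial. *)
Let cube_rel x y : x \in G -> y \in G ->
  commf [~ x, y] [:: x; x] ^+ 3 * comm4 [~ x, y] y y x x = 1.
Proof.
move=> Gx Gy; have Py : y ^+ 3 \in 'Phi(G) by rewrite -p3; apply: expp_Phi.
have Lv : [~ x, y] \in 'L_2(G) by apply: (@mem_lcn_commS _ _ 1).
have Lv1 := mem_lcn_commS Lv Gy; have Lv2 := mem_lcn_commS Lv1 Gy.
have Lv23 : [~ [~ [~ x, y], y], y] \in 'L_3(G) by apply: mem_lcn_leq Lv2 _.
transitivity (commf x [:: y ^+ 3; x; x]); last first.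
  by near x Py Py; rewrite Gx groupX.
rewrite -[RHS]/(commf [~ x, y ^+ 3] [:: x; x]) commg_cube commf_cube2 //.
rewrite [X in _ * X * _]exp5 ?mulg1 //.
by apply: (@mem_lcn_commf _ _ 3) => //=; rewrite Gx.
Qed.

Section FixedCommutator.

Variable u : gT.
Hypothesis Lu : u \in 'L_2(G).
Local Notation f := (comm4 u).
Local Notation fvan := (comm4_vanish Lu).

Let h x y := commf u [:: x; y] ^+ 3.

Let L4 x y : x \in G -> y \in G -> commf u [:: x; y] \in 'L_4(G).
Proof. by move=> Gx Gy; apply: (@mem_lcn_commf _ _ 2) => //=; rewrite Gx Gy. Qed.

Let hM1 x x' y : x \in G -> x' \in G -> y \in G ->
  h (x * x') y = h x y * h x' y.
Proof.
move=> Gx Gx' Gy; rewrite -(lcn_expMn L7 3 (isT : (4 <= 4)%N)) ?L4 //.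
apply: (eqlcn_expg L7 (isT : (4 <= 4)%N)) => //; first by rewrite groupM ?L4.
by apply: (@commfMr _ _ 1 u [::] x x' [:: y]) => //=; rewrite Gy.
Qed.

Let hM2 x y y' : x \in G -> y \in G -> y' \in G ->
  h x (y * y') = h x y * h x y'.
Proof.
move=> Gx Gy Gy'; rewrite -(lcn_expMn L7 3 (isT : (4 <= 4)%N)) ?L4 //.
apply: (eqlcn_expg L7 (isT : (4 <= 4)%N)) => //; first by rewrite groupM ?L4.
by apply: (@commfMr _ _ 1 u [:: x] y y' [::]) => //=; rewrite Gx.
Qed.

(* [ba, b] = [a, b], so the relation [cube_rel] holds for both (a, b) and (ba, b). *)
Let h_rel a b : a \in G -> b \in G -> u = [~ a, b] ->
  h b b * (h b a * h a b) = 1.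
Proof.
move=> Ga Gb def_u; have Gba := groupM Gb Ga.
have def_u' : u = [~ b * a, b] by rewrite commMgJ commgg conj1g mul1g.
have := cube_rel Gba Gb; rewrite -def_u' -/(h _ _).
rewrite (comm4M3 L7 Lu) // !(comm4M4 L7 Lu) // !fvan // ?(mulg1, mul1g).
rewrite hM1 // !hM2 // -mulgA -(mulgA (h a b)).
by have := cube_rel Ga Gb; rewrite -def_u -/(h _ _) => ->; rewrite mulg1 -mulgA.
Qed.

(** Comparing [h_rel] for (a, b) and (ba, b) gives h(b,b)^2 = 1, and h(b,b) is a 3-element. *)
Lemma commf_expg3_eq1 a b : a \in G -> b \in G -> u = [~ a, b] ->
  commf u [:: b; b] ^+ 3 = 1.
Proof.
move=> Ga Gb def_u; rewrite -/(h b b); have Gba := groupM Gb Ga.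
have def_u' : u = [~ b * a, b] by rewrite commMgJ commgg conj1g mul1g.
have Lh x y : x \in G -> y \in G -> h x y \in 'L_4(G).
  by move=> Gx Gy; rewrite groupX ?L4.
have := h_rel Gba Gb def_u'; rewrite hM2 // hM1 //.
have -> : h b b * h b a * (h b b * h a b) = h b b * h b b * (h b a * h a b).
  rewrite -!(mulgA (h b b)); congr (_ * _); rewrite !(mulgA _ _ (h a b)).
  congr (_ * _); apply: (centsP (abelian_lcn L7 (isT : 4 <= 4)%N)); exact: Lh.
have := h_rel Ga Gb def_u; move: (Lh _ _ Gb Gb); move: (h b b) => X LX.
move=> XY; rewrite -(mulgA X X) XY mulg1 => XX.
have /p_natP[k oX] : p.-elt X by apply: mem_p_elt pG (memLG LX).
have : #[X] %| 2 by rewrite order_dvdn expgS expg1 XX.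
case: k oX => [/eqP | k ->]; first by rewrite order_eq1 => /eqP.
by rewrite p3 expnS => /(dvdn_trans (dvdn_mulr _ (dvdnn 3))).
Qed.

(** Expanding f(ab, ab, ab, b) leaves aabb, abab and baab; the last two agree, so their common value
    has trivial square and trivial cube. *)
Lemma comm4_words3 a b : a \in G -> b \in G -> commute u [~ a, b] ->
  f a a b b = 1 -> f a b a b = 1 /\ f b a a b = 1.
Proof.
move=> Ga Gb cu aabb; have Gc := groupM Ga Gb; have := comm4_xxxz Lu Gc Gb.
rewrite (comm4M1 L7 Lu) // !(comm4M2 L7 Lu) // !(comm4M3 L7 Lu) //
    !fvan // ?(mulg1, mul1g).
rewrite aabb mul1g (comm4_sym L7 Lu Gb Ga) //; last by rewrite -invg_comm; apply: commuteV.
move=> sq1; have /exp6 := comm4_mem Lu Ga Gb Ga Gb.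
by rewrite expgS expgS expg1 sq1 mulg1.
Qed.

End FixedCommutator.

Lemma comm4_bbaa3 a b : a \in G -> b \in G -> comm4 [~ a, b] b b a a = 1.
Proof.
move=> Ga Gb; have Gaa : all (mem G) [:: a; a] by rewrite /= Ga.
have Lu : [~ a, b] \in 'L_2(G) by apply: (@mem_lcn_commS _ _ 1).
have Lu' : [~ b, a] \in 'L_2(G) by apply: (@mem_lcn_commS _ _ 1).
have L4 v : v \in 'L_2(G) -> commf v [:: a; a] \in 'L_4(G).
  by move=> Lv; apply: (@mem_lcn_commf _ _ 2).
(* The cube is trivial for [b, a]; it carries over to the inverse [a, b] by multiplicativity modulo
   ['L_5(G)]. *)
have e1 := commf_expg3_eq1 Lu' Gb Ga (erefl _).
have := cube_rel Ga Gb; suff -> : commf [~ a, b] [:: a; a] ^+ 3 = 1 by rewrite mul1g.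
have := @commfM _ G 1 _ _ _ Lu Lu' Gaa; rewrite -{1}(invg_comm a b) mulgV commf1.
move/(eqlcn_expg L7 (isT : 4 <= 4)%N (groupM (L4 _ Lu) (L4 _ Lu')))/(_ exp5).
by rewrite (lcn_expMn L7 3 (isT : 4 <= 4)%N (L4 _ Lu) (L4 _ Lu')) e1 mulg1 expg1n.
Qed.

Lemma comm4_aabb3 a b : a \in G -> b \in G -> comm4 [~ a, b] a a b b = 1.
Proof.
move=> Ga Gb; have Gs : all (mem G) [:: a; a; b; b] by rewrite /= Ga Gb.
have Lu : [~ a, b] \in 'L_2(G) by apply: (@mem_lcn_commS _ _ 1).
have Lu' : [~ b, a] \in 'L_2(G) by apply: (@mem_lcn_commS _ _ 1).
have /(eqlcn7 L7) := @commfM _ G 1 _ _ _ Lu Lu' Gs.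
rewrite -{1}(invg_comm a b) mulgV commf1 => /esym.
by rewrite -/(comm4 _ _ _ _ _) -/(comm4 [~ b, a] _ _ _ _) comm4_bbaa3 // mulg1.
Qed.

End ExponentThree.

(** * Exponents of the last terms, and the two-generator case *)

Section TwoGenerators.

Variables a b : gT.
Hypotheses (Ga : a \in G) (Gb : b \in G) (genab : <<[set a; b]>> = G).

Let sabG x : x \in [set a; b] -> x \in G.
Proof. by case/set2P=> ->. Qed.

(** In an abelian group the solutions of e^p = 1 form a subgroup, so only commutators of generators
    need checking. *)
Lemma exp_lcn6 e : e \in 'L_6(G) -> e ^+ p = 1.
Proof.
suffices: 'L_6(G) \subset Group (group_Ldiv p (abelian_lcn L7 (isT : (4 <= 6)%N))).
  by move/subsetP=> s6 /s6; rewrite !inE => /andP[_ /eqP].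
apply: (@lcn_sub_commf _ _ [set a; b]) => //; first by rewrite L7 sub1G.
move=> x [|x2 [|y1 [|y2 [|y3 [|y4 []]]]]] //= Xx.
case/and5P=> Xx2 Xy1 Xy2 Xy3 /andP[Xy4 _] _.
have Lu : [~ x, x2] \in 'L_2(G) by apply: (@mem_lcn_commS _ _ 1); apply: sabG.
rewrite !inE [_ \in 'L_6(G)](comm4_mem Lu) ?sabG //=; apply/eqP.
by apply: (@comm4_expp _ Lu y1 y2 y3 y4 a b) => //; apply: sabG.
Qed.


(** Two of the three entries after u equal some v. The cube moves to the remaining entry z, and u,
    v, v, z^3 lie in one maximal subgroup. *)
Lemma exp_lcn5 : p = 3 -> forall e, e \in 'L_5(G) -> e ^+ 3 = 1.
Proof.
move=> p3; have exp6 e : e \in 'L_6(G) -> e ^+ 3 = 1.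
  by move=> Le; have := exp_lcn6 Le; rewrite p3.
suffices: 'L_5(G) \subset Group (group_Ldiv 3 (abelian_lcn L7 (isT : (4 <= 5)%N))).
  by move/subsetP=> s5 e /s5; rewrite !inE => /andP[_ /eqP].
apply: (@lcn_sub_commf _ _ [set a; b]) => //.
  apply/subsetP=> e Le; rewrite !inE [_ \in 'L_5(G)](mem_lcn_leq Le) //=.
  by rewrite exp6.
move=> x [|x2 [|y1 [|y2 [|y3 []]]]] //= Xx.
case/and5P=> Xx2 Xy1 Xy2 Xy3 _ _.
have Lu : [~ x, x2] \in 'L_2(G) by apply: (@mem_lcn_commS _ _ 1); apply: sabG.
move: [~ x, x2] Lu => u Lu.
have Gu : u \in G by apply: subsetP (lcn_sub _ _) _ Lu.
have Pu := lcn2_Phi Lu.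
have L5 x1 x3 x4 : x1 \in G -> x3 \in G -> x4 \in G -> commf u [:: x1; x3; x4] \in 'L_5(G).
  by move=> G1 G3 G4; apply: (@mem_lcn_commf _ _ 2); rewrite //= G1 G3 G4.
rewrite !inE [_ \in 'L_5(G)](L5 y1 y2 y3) ?sabG //=; apply/eqP.
have cubeP z : z \in G -> z ^+ 3 \in 'Phi(G) by rewrite -p3; apply: expp_Phi.
(* The condition on n puts [w, z, z, s] in weight 6, where cubes vanish, and [w, z, z, z, s] in
   weight 7. *)
have cube1 w z s n : w \in 'L_n.+2(G) -> z \in G -> all (mem G) s -> (n + size s = 2)%N ->
    commf w (z ^+ 3 :: s) = 1 -> commf w (z :: s) ^+ 3 = 1.
  move=> Lw Gz Gs ns; have Lw2 := mem_lcn_leq Lw (isT : 2 <= n.+2)%N.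
  rewrite (commf_cube L7) // => <-.
  have L6w : commf w [:: z, z & s] \in 'L_6(G).
    have := @mem_lcn_commf _ _ _ w [:: z, z & s] Lw.
    by rewrite /= Gz Gs !addnS !addSn ns; apply.
  have L7w : commf w [:: z, z, z & s] \in 'L_7(G).
    have := @mem_lcn_commf _ _ _ w [:: z, z, z & s] Lw.
    by rewrite /= Gz Gs !addnS !addSn ns; apply.
  by move: L7w; rewrite L7 => /set1gP ->; rewrite (exp6 _ L6w) !mulg1.
have zxx z v : z \in G -> v \in G -> commf u [:: z; v; v] ^+ 3 = 1.
  move=> Gz Gv; have Pz := cubeP z Gz.
  apply: (cube1 _ _ _ 0 Lu) => //=; first by rewrite Gv.
  rewrite -[LHS]/(commf u [:: z ^+ 3; v; v]).
  by near v Pu Pz; rewrite Gu groupX // Gv.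
have xzx z v : z \in G -> v \in G -> commf u [:: v; z; v] ^+ 3 = 1.
  move=> Gz Gv; have Pz := cubeP z Gz.
  rewrite -[commf _ _]/(commf [~ u, v] [:: z; v]).
  apply: (cube1 [~ u, v] _ [:: v] 1%N (mem_lcn_commS Lu Gv)) => //=; first by rewrite Gv.
  rewrite -[LHS]/(commf u [:: v; z ^+ 3; v]).
  by near v Pu Pz; rewrite Gu groupX // Gv.
have xxz z v : z \in G -> v \in G -> commf u [:: v; v; z] ^+ 3 = 1.
  move=> Gz Gv; have Pz := cubeP z Gz.
  rewrite -[commf _ _]/(commf [~ [~ u, v], v] [:: z]).
  apply: (cube1 [~ [~ u, v], v] _ [::] 2 (mem_lcn_commS (mem_lcn_commS Lu Gv) Gv)) => //=.
  rewrite -[LHS]/(commf u [:: v; v; z ^+ 3]).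
  by near v Pu Pz; rewrite Gu groupX // Gv.
case/set2P: Xy1 => ->; case/set2P: Xy2 => ->; case/set2P: Xy3 => ->;
  solve [exact: zxx | exact: xzx | exact: xxz].
Qed.

Lemma lcn6_2gen_eq1 : p = 2 \/ p = 3 -> 'L_6(G) = 1.
Proof.
move=> p23; apply: (@lcn_eq1_commf _ _ [set a; b]) => //; first exact: pgroup_nil pG.
(* Both orders of the first two letters occur; either way u commutes with [a, b], as the symmetry of
   f requires. *)
have words u : u \in 'L_2(G) -> u = [~ a, b] \/ u = [~ b, a] ->
    [/\ comm4 u a a b b = 1, comm4 u b b a a = 1, comm4 u a b a b = 1 /\ comm4 u b a a b = 1
      & comm4 u b a b a = 1 /\ comm4 u a b b a = 1].
  move=> Lu def_u.
  have cu : commute u [~ a, b].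
    by case: def_u => ->; rewrite // -invg_comm; apply/commute_sym/commuteV.
  have cu' : commute u [~ b, a] by rewrite -invg_comm; apply: commuteV.
  case: p23 => [p2 | p3].
    have exp6 e : e \in 'L_6(G) -> e ^+ 2 = 1.
      by move=> Le; have := exp_lcn6 Le; rewrite p2.
    have [? ? ?] := comm4_words2 p2 exp6 Lu Ga Gb cu.
    by have [? ? ?] := comm4_words2 p2 exp6 Lu Gb Ga cu'.
  have exp5 := exp_lcn5 p3.
  have [aabb bbaa] : comm4 u a a b b = 1 /\ comm4 u b b a a = 1.
    by case: def_u => ->; rewrite ?comm4_bbaa3 ?comm4_aabb3.
  have [? ?] := comm4_words3 exp5 Lu Ga Gb cu aabb.
  by have [? ?] := comm4_words3 exp5 Lu Gb Ga cu' bbaa.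
move=> x [|x2 [|y1 [|y2 [|y3 [|y4 []]]]]] //= Xx.
case/and5P=> Xx2 Xy1 Xy2 Xy3 /andP[Xy4 _] _.
have Lu : [~ x, x2] \in 'L_2(G) by apply: (@mem_lcn_commS _ _ 1); apply: sabG.
rewrite -[LHS]/(comm4 [~ x, x2] y1 y2 y3 y4).
have [-> | /(words _ Lu)[]] : [~ x, x2] = 1 \/ ([~ x, x2] = [~ a, b] \/ [~ x, x2] = [~ b, a]).
  by case/set2P: Xx => ->; case/set2P: Xx2 => ->; rewrite ?commgg; tauto.
  by rewrite /comm4 commf1.
move: [~ x, x2] Lu => u Lu aabb bbaa [abab baab] [baba abba].
(* The ten words other than these six repeat a letter at least three times. *)
by case/set2P: Xy1 => ->; case/set2P: Xy2 => ->; case/set2P: Xy3 => ->;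
   case/set2P: Xy4 => ->; rewrite // (comm4_vanish Lu).
Qed.

End TwoGenerators.

End Main.

Theorem mainTheorem1 (p : nat) (gT : finGroupType) (G : {group gT}) :
  prime p -> minimal_class_gt p 3 G -> p = 2 \/ p = 3 -> (nil_class G <= 5)%N.
Proof.
move=> p_pr [pG cl_G subG] p23; have nilG := pgroup_nil pG.
have ncG : ~~ cyclic G.
  apply: contraL cl_G => /cyclic_abelian; rewrite -nil_class1 -leqNgt.
  by move/leq_trans; apply.
(* The index is one above the class: class at most 3 means ['L_4(M) = 1], and class at most 5 means
   ['L_6(G) = 1]. *)
have max4 (M : {group gT}) : maximal M G -> 'L_4(M) = 1.
  case/maxgroupp/(fun H => (H, subG _ H)) => ltMG clM.
  by apply/lcn_nil_classP => //; apply: nilpotentS (proper_sub ltMG) nilG.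
apply/lcn_nil_classP => //.
have [// | [a [b [Ga Gb genab]]]] := lcn6_or_2gen pG ncG max4.
exact: lcn6_2gen_eq1 Ga Gb genab p23.
Qed.
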